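(* For $n\ge 4$ and $k=1,\ldots,n-3$, $$\operatorname{Aut}(\mathbb{R}_+^{n,(k)})=\{\alpha P\mid \alpha>0,\ P \text{ is an } n\times n \text{ permutation matrix}\}.$$
   Context: $\mathbb{R}_+^{n,(k)}$ denotes the $k$-th derivative relaxation of the nonnegative orthant $\mathbb{R}^n_+$, where $\mathbb{R}^n_+$ is realized as the hyperbolicity cone of $p(x)=x_1x_2\cdots x_n$ along $e=(1,1,\ldots,1)^T$. That is, $\mathbb{R}_+^{n,(k)}=\Lambda_+(D_e^kp,e)$, where $D_e^kp(x)=\frac{d^k}{dt^k}p(x+te)|_{t=0}$ and, for a homogeneous polynomial $g$ that is hyperbolic along $e$ (i.e. $g(e)>0$ and $t\mapsto g(x-te)$ has only real roots for every $x$), $\Lambda_+(g,e)=\{x\in\mathbb{R}^n\mid\text{all roots of } t\mapsto g(te-x)\text{ are nonnegative}\}$. Equivalently, for $k=1,\ldots,n-1$, $$\mathbb{R}_+^{n,(k)}=\{x\in\mathbb{R}^n\mid s_i(x)\ge 0,\ i=1,\ldots,n-k\},$$ where $s_i(x)=\sum_{1\le j_1<\cdots<j_i\le n}x_{j_1}\cdots x_{j_i}$ is the elementary symmetric polynomial of degree $i$. For a cone $K\subseteq\mathbb{R}^n$, $\operatorname{Aut}(K)=\{A\in \mathrm{GL}_n(\mathbb{R})\mid AK=K\}$. *)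

(* Defs.v *)
From HB Require Import structures.
From mathcomp Require Import all_boot all_order all_algebra.
From mathcomp Require Import all_classical all_reals all_analysis.

Set Implicit Arguments.
Unset Strict Implicit.
Unset Printing Implicit Defensive.

Import Order.TTheory GRing.Theory Num.Theory.
Import numFieldNormedType.Exports.

Local Open Scope classical_set_scope.
Local Open Scope ring_scope.

(* Polynomials on R^n are represented by the functions they induce. *)

Definition dir_derivative (R : realType) (n k : nat)
    (e : 'cV[R]_n) (g : 'cV[R]_n -> R) (x : 'cV[R]_n) : R :=
  derive1n k (fun t : R => g (x + t *: e)) 0.

(* Only meant for g a homogeneous polynomial hyperbolic along e: all complex
   roots of t |-> g (t e - x) are then real, so quantifying over the real roots
   loses nothing. *)
Definition hyperbolicity_cone (R : realType) (n : nat)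
    (g : 'cV[R]_n -> R) (e : 'cV[R]_n) : set 'cV[R]_n :=
  [set x | forall t : R, g (t *: e - x) = 0 -> 0 <= t].

Definition coord_prod (R : realType) (n : nat) (x : 'cV[R]_n) : R :=
  \prod_(i < n) x i 0.

Definition ones (R : realType) (n : nat) : 'cV[R]_n := const_mx 1.
Arguments ones : clear implicits.

Definition orthant_relaxation (R : realType) (n k : nat) : set 'cV[R]_n :=
  hyperbolicity_cone (dir_derivative k (ones R n) (@coord_prod R n)) (ones R n).
Arguments orthant_relaxation : clear implicits.

Definition cone_aut (R : realType) (n : nat) (K : set 'cV[R]_n) :
    set 'M[R]_n :=
  [set A : 'M[R]_n | A \in unitmx /\ [set A *m x | x in K] = K].

(* Main.v *)
Require Import Defs.
From HB Require Import structures.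
From mathcomp Require Import all_boot all_order all_algebra.
From mathcomp Require Import all_classical all_reals all_analysis.
From mathcomp Require Import perm complex polyrcf ring lra zify.

(** Write f_x = prod_i (X + x_i).  Its coefficient of index j is the elementary
    symmetric function s_(n-j) of x, and the k-th derivative of the coordinate
    product along (1, ..., 1) is, up to sign, the k-th derivative of f_x
    evaluated at a reflected point.  Since derivatives of real-rooted
    polynomials are real-rooted, the relaxed cone K is the set of x such that
    f_x has nonnegative coefficients in all degrees j >= k
    ([mem_relaxation_coef]).

    The extreme rays of the orthant can be recognised from K alone, as sharp
    points of its boundary.  Say that K has a tangent half-space at x when, for
    some nonzero linear form l, every direction y with l(y) > 0 points into K
    from x; an automorphism of K carries this property from the image of a
    point back to the point.

    - Laguerre's inequality q q'' < q'^2, applied to the derivatives of f_x at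
      0, shows that for x in K either x lies in the orthant or all coefficients
      of f_x in degrees j > k are positive ([relaxation_dichotomy]).  In the
      second case s_(n-k) has nonzero gradient at x, and this gradient defines a
      tangent half-space ([tangent_halfspace_relaxation]).
    - At a coordinate vector e_i there is none: as k <= n - 3, K satisfies
      s_3 >= 0, and s_3(e_i + t y) behaves like t^2 s_2 of the other coordinates
      of y, a form that takes negative values on both sides of every hyperplane
      ([no_tangent_halfspace_delta]).

    Therefore an automorphism A sends each e_i into the orthant; so does its
    inverse, and a nonnegative matrix with nonnegative inverse is a permutation
    matrix with positively rescaled columns ([nonneg_inverse_monomial]).

    The scaling factors d_i all agree.  Let T be a set of n - k - 1 indices.  At
    the 0/1 vector of T the tangent half-space is given by the sum of the
    coordinates outside T, whatever positive values are taken on T.  Hence the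
    linear forms with coefficients 1 and d_l, over l outside T, define the same
    half-space.  Concretely, when d_i < d_j the direction e_i - c e_j with c < 1
    close enough to 1 points into K before applying A and out of K afterwards
    ([monomial_aut_constant]).  Any two indices lie outside some T because
    k >= 1.

    Conversely, elementary symmetric functions are symmetric and homogeneous,
    so positive multiples of permutation matrices preserve K. *)

Set Implicit Arguments.
Unset Strict Implicit.
Unset Printing Implicit Defensive.

Import Order.TTheory GRing.Theory Num.Theory.
Import numFieldNormedType.Exports.
Local Open Scope classical_set_scope.
Local Open Scope ring_scope.

(** * Real-rooted polynomials *)

Definition real_rooted (R : realFieldType) (p : {poly R}) : Prop :=
  exists (c : R) (rs : seq R), p = c *: \prod_(r <- rs) ('X - r%:P).

Lemma size_real_rooted (R : realFieldType) (c : R) (rs : seq R) : c != 0 ->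
  size (c *: \prod_(r <- rs) ('X - r%:P)) = (size rs).+1.
Proof. by move=> c0; rewrite size_scale // size_prod_XsubC. Qed.

Lemma deriv_XsubCM (R : comNzRingType) (r : R) (q : {poly R}) :
  (('X - r%:P) * q)^`() = q + ('X - r%:P) * q^`().
Proof. by rewrite derivM derivB derivX derivC subr0 mul1r. Qed.

(** Away from the roots, (q'/q)' is minus a sum of squares 1/(a - r)^2; clearing
    denominators gives a strict inequality as soon as there is a root. *)
Lemma laguerre (R : realFieldType) (p : {poly R}) (a : R) :
  real_rooted p -> (1 < size p)%N -> p.[a] != 0 ->
  p.[a] * p^`()^`().[a] < p^`().[a] ^+ 2.
Proof.
move=> [c [rs ->]] sp; have c0 : c != 0.
  by apply: contraTneq sp => ->; rewrite scale0r size_poly0.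
move: sp; rewrite size_real_rooted // ltnS => srs.
rewrite !derivZ !hornerZ mulf_eq0 (negPf c0) /= => pa0.
(* Adjoining the root r turns q'^2 - q q'' into q^2 + (X - r)^2 (q'^2 - q q''). *)
have weak (s : seq R) : let q := \prod_(r <- s) ('X - r%:P) in
    0 <= q^`().[a] ^+ 2 - q.[a] * q^`()^`().[a].
  elim: s => [|r s /= IH] /=.
    by rewrite big_nil -polyC1 !derivC !horner0 mulr0 expr0n subrr.
  rewrite big_cons; set q := \prod_(r <- s) _ in IH *.
  rewrite !(deriv_XsubCM, derivD) !hornerE /=.
  have := addr_ge0 (sqr_ge0 q.[a]) (mulr_ge0 (sqr_ge0 (a - r)) IH).
  by congr (0 <= _); ring.
case: rs srs pa0 => [//|r s] _; rewrite big_cons; have := weak s => /=.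
set q := \prod_(r <- s) _ => IH; rewrite hornerM mulf_eq0 negb_or => /andP[ar qa0].
rewrite -subr_gt0 !(deriv_XsubCM, derivD) !hornerE /=.
have q2 : 0 < q.[a] ^+ 2 by rewrite exprn_even_gt0.
have c2 : 0 < c ^+ 2 by rewrite exprn_even_gt0.
have := mulr_gt0 c2 (ltr_pwDl q2 (mulr_ge0 (sqr_ge0 (a - r)) IH)).
by congr (0 < _); ring.
Qed.

(** The Gauss-Lucas argument.  At a non-real z no factor z - r vanishes, and
    q'/q = sum 1/(z - r) has an imaginary part of sign opposite to that of z, so
    q'(z) is nonzero.  The quotient q'/q is replaced below by q' times the
    conjugate of q, which has the same sign of imaginary part and can be computed
    by induction on the list of roots. *)
Lemma deriv_root_real (R : rcfType) (rs : seq R) (z : R[i]) :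
  rs != [::] ->
  root (map_poly (real_complex R) (\prod_(r <- rs) ('X - r%:P))^`()) z ->
  complex.Im z = 0.
Proof.
move=> rs0; set F := fun s : seq R => map_poly (real_complex R) (\prod_(r <- s) ('X - r%:P)).
have FS r s : F (r :: s) = ('X - (r%:C)%C%:P) * F s.
  by rewrite /F big_cons rmorphM rmorphB /= map_polyX map_polyC.
rewrite -deriv_map => dz; apply/eqP; apply: contraT => z0.
have Fz s : (F s).[z] != 0.
  rewrite /F map_prod_XsubC; apply/negP => /eqP/rootP.
  rewrite -[X in root X]/(\prod_(r <- s) _).
  rewrite -(big_map (real_complex R) predT (fun r => 'X - r%:P)) root_prod_XsubC.
  by case/mapP => r _ zr; move: z0; rewrite zr eqxx.
have sgn s : let w := (F s)^`().[z] * conjc (F s).[z] in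
    complex.Im z * complex.Im w <= 0 /\ (s != [::] -> complex.Im z * complex.Im w < 0).
  elim: s => [|r s [IH _]] /=.
    rewrite /F big_nil rmorph1 -polyC1 derivC horner0 mul0r /=.
    by rewrite mulr0; split.
  suff lt0 : complex.Im z * complex.Im ((F (r :: s))^`().[z] * conjc (F (r :: s)).[z]) < 0.
    by split=> // ; apply: ltW.
  rewrite FS deriv_XsubCM !hornerE.
  have := Fz s; move: IH => /=.
  move: (F s).[z] (F s)^`().[z] => [g1 g2] [h1 h2] /=.
  case: z {dz Fz} z0 => [z1 z2] /= z20 IH.
  rewrite eq_complex /= negb_and => gn0.
  have g2gt : 0 < g1 ^+ 2 + g2 ^+ 2.
    case/orP: gn0 => h; first by rewrite ltr_pwDl ?sqr_ge0 // exprn_even_gt0.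
    by rewrite ltr_wpDl ?sqr_ge0 // exprn_even_gt0.
  have z2gt : 0 < z2 ^+ 2 by rewrite exprn_even_gt0.
  have P1 := mulr_gt0 z2gt g2gt.
  have P2 := mulr_ge0 (addr_ge0 (sqr_ge0 (z1 - r)) (sqr_ge0 z2))
    (_ : 0 <= - (z2 * (h1 * - g2 + h2 * g1))).
  rewrite -oppr_gt0.
  have := ltr_pwDl P1 (P2 _); rewrite oppr_ge0 => /(_ IH).
  by congr (0 < _); ring.
have [_ /(_ rs0)] := sgn rs.
by rewrite (rootP dz) mul0r mulr0 ltxx.
Qed.

(** Split the derivative over the complex numbers: all its roots are real, so
    the factorisation descends. *)
Lemma real_rooted_deriv (R : rcfType) (p : {poly R}) :
  real_rooted p -> real_rooted p^`().
Proof.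
move=> [c [rs ->]]; rewrite derivZ; have [->|rs0] := eqVneq rs [::].
  by exists 0, [::]; rewrite big_nil -polyC1 derivC !scaler0 scale0r.
set q := _^`().
have [zs qE] := closed_field_poly_normal (map_poly (real_complex R) q).
have [q0|q0] := eqVneq q 0; first by exists 0, [::]; rewrite q0 scaler0 scale0r.
have zreal z : z \in zs -> (complex.Re z)%:C%C = z.
  move=> zzs; have : root (map_poly (real_complex R) q) z.
    rewrite qE rootZ ?lead_coef_eq0 ?map_poly_eq0 //.
    by rewrite root_prod_XsubC.
  by move/(deriv_root_real rs0); case: z {zzs} => a b /= ->.
exists (c * lead_coef q), (map (@complex.Re R) zs).
rewrite -scalerA; congr (_ *: _); apply: (map_poly_inj (real_complex R)).
rewrite qE lead_coef_map /= map_polyZ /=; congr (_ *: _).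
rewrite big_map map_prod_XsubC; apply: eq_big_seq => z zzs /=.
by rewrite zreal.
Qed.

Lemma real_rooted_derivn (R : rcfType) (p : {poly R}) (k : nat) :
  real_rooted p -> real_rooted p^`(k).
Proof. by move=> rp; elim: k => // k IH; rewrite derivnS; apply: real_rooted_deriv. Qed.

Lemma coef_ge0_prod (R : realFieldType) (I : Type) (s : seq I) (P : pred I) (F : I -> {poly R}) :
  (forall i, P i -> forall j, 0 <= (F i)`_j) -> forall j, 0 <= (\prod_(i <- s | P i) F i)`_j.
Proof.
move=> F0; elim/big_ind: _ => [j|p q p0 q0 j|//]; first by rewrite coef1 ler0n.
by rewrite coefM sumr_ge0 // => i _; rewrite mulr_ge0.
Qed.

Lemma coef_ge0_real_rooted (R : realFieldType) (p : {poly R}) (l : nat) :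
  real_rooted p -> 0 < p`_l -> (forall t, root p t -> t <= 0) ->
  forall j, 0 <= p`_j.
Proof.
move=> [c [rs ->]]; rewrite coefZ => cl rt.
have c0 : c != 0 by apply: contraTneq cl => ->; rewrite mul0r ltxx.
have q0 j : 0 <= (\prod_(r <- rs) ('X - r%:P))`_j.
  rewrite big_seq; apply: coef_ge0_prod => r rrs i.
  have r0 : r <= 0 by apply: rt; rewrite rootZ // root_prod_XsubC.
  rewrite coefB coefX coefC; case: (i == 0%N); last by rewrite subr0 ler0n.
  by rewrite addr_ge0 ?ler0n ?oppr_ge0.
move=> j; rewrite coefZ mulr_ge0 // leNgt; apply/negP => clt0.
by move: cl; rewrite ltNge mulr_le0_ge0 // ltW.
Qed.

Lemma horner_gt0 (R : realFieldType) (p : {poly R}) (t : R) :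
  (forall j, 0 <= p`_j) -> p != 0 -> 0 < t -> 0 < p.[t].
Proof.
move=> p0 pn0 t0; rewrite horner_coef.
have sp : (0 < size p)%N by rewrite size_poly_gt0.
rewrite (bigD1 (Ordinal (_ : (size p).-1 < size p)%N)) ?prednK //= => h.
rewrite ltr_pwDl ?sumr_ge0 // => [|i _]; last by rewrite mulr_ge0 // exprn_ge0 ?ltW.
by rewrite mulr_gt0 ?exprn_gt0 // lt_def p0 andbT -lead_coefE lead_coef_eq0.
Qed.

(** * The relaxed cone through the coefficients of a product *)

(** The coefficient of index j is the elementary symmetric function of degree
    n - j of the coordinates. *)
Definition shift_poly (R : realType) (n : nat) (x : 'cV[R]_n) : {poly R} :=
  \prod_(i < n) ('X + (x i 0)%:P).

Section ShiftPoly.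
Variables (R : realType) (n : nat).
Implicit Types (x y : 'cV[R]_n) (k : nat).

Lemma shift_polyE x :
  shift_poly x = \prod_(r <- [seq - x i 0 | i <- index_enum 'I_n]) ('X - r%:P).
Proof. by rewrite big_map; apply: eq_bigr => i _; rewrite polyCN opprK. Qed.

Lemma real_rooted_shift_poly x : real_rooted (shift_poly x).
Proof. by exists 1, [seq - x i 0 | i <- index_enum 'I_n]; rewrite scale1r shift_polyE. Qed.

Lemma monic_shift_poly x : shift_poly x \is monic.
Proof. by rewrite shift_polyE monic_prod_XsubC. Qed.

Lemma size_shift_poly x : size (shift_poly x) = n.+1.
Proof.
by rewrite shift_polyE size_prod_XsubC size_map [index_enum _]unlock -enumT size_enum_ord.
Qed.

Lemma coefn_shift_poly x : (shift_poly x)`_n = 1.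
Proof.
by have /monicP := monic_shift_poly x; rewrite lead_coefE size_shift_poly.
Qed.

Lemma derive1n_horner k (p : {poly R}) : derive1n k (horner p) = horner p^`(k).
Proof. by elim: k => [|k IH]; rewrite ?derive1n0 // derive1nS IH -derivE. Qed.

Lemma derivn_comp_reflect k (p : {poly R}) (t : R) :
  (p \Po (- 'X - t%:P))^`(k) = (-1) ^+ k *: (p^`(k) \Po (- 'X - t%:P)).
Proof.
elim: k => [|k IH]; first by rewrite scale1r.
rewrite derivnS IH derivZ deriv_comp derivB derivN derivX derivC subr0 -derivnS.
by rewrite mulrN1 scalerN exprS mulN1r scaleNr.
Qed.

(** Both sides come from prod_i (X + t - x_i) = (-1)^n f_x(- X - t). *)
Lemma dir_derivative_coord_prod k x (t : R) :
  dir_derivative k (ones R n) (@coord_prod R n) (t *: ones R n - x)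
  = (-1) ^+ n * (-1) ^+ k * (shift_poly x)^`(k).[- t].
Proof.
rewrite /dir_derivative.
have -> : (fun s => coord_prod (t *: ones R n - x + s *: ones R n)) =
    horner ((-1) ^+ n *: (shift_poly x \Po (- 'X - t%:P))).
  apply/funext => s; rewrite hornerZ horner_comp /shift_poly horner_prod.
  rewrite -[n in (-1) ^+ n]card_ord -prodr_const -big_split; apply: eq_bigr => i _ /=.
  by rewrite !mxE !hornerE; ring.
rewrite derive1n_horner derivnZ derivn_comp_reflect !hornerZ horner_comp mulrA.
by rewrite !hornerE ?oppr0 ?add0r.
Qed.

Lemma mem_relaxation_root k x :
  orthant_relaxation R n k x <-> forall t, root (shift_poly x)^`(k) t -> t <= 0.
Proof.
split=> [Kx t /rootP rt|rt t].
  rewrite -oppr_ge0; apply: Kx.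
  by rewrite dir_derivative_coord_prod opprK rt mulr0.
move/eqP; rewrite dir_derivative_coord_prod -exprD mulf_eq0 signr_eq0 /=.
by move/rt; rewrite oppr_le0.
Qed.

(** A real-rooted polynomial with a positive coefficient has no positive root
    exactly when all its coefficients are nonnegative. *)
Lemma mem_relaxation_coef k x : (k <= n)%N ->
  orthant_relaxation R n k x <-> forall j, (k <= j)%N -> 0 <= (shift_poly x)`_j.
Proof.
move=> kn; rewrite mem_relaxation_root.
(* f_x is monic of degree n, so its k-th derivative is nonzero in degree n - k. *)
have top : 0 < (shift_poly x)^`(k)`_(n - k).
  by rewrite coef_derivn subnKC // coefn_shift_poly pmulrn_lgt0 ?ltr01 // ffact_gt0.
split=> [rt j kj|p0 t].
  have := coef_ge0_real_rooted (real_rooted_derivn k (real_rooted_shift_poly x)) top rt (j - k).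
  by rewrite coef_derivn subnKC // pmulrn_lge0 // ffact_gt0.
apply: contraTT; rewrite -ltNge => t0; rewrite rootE gt_eqF //.
apply: horner_gt0 => // [j|]; first by rewrite coef_derivn mulrn_wge0 // p0 ?leq_addr.
by apply: contraTneq top => ->; rewrite coef0 ltxx.
Qed.

(** Laguerre's inequality at 0 for the derivative of order j - 1, whose value
    and first two derivatives at 0 are multiples of the coefficients of index
    j - 1, j and j + 1. *)
Lemma shift_poly_newton x j : (0 < j <= n)%N -> (shift_poly x)`_j = 0 ->
  (shift_poly x)`_j.-1 = 0 \/ (shift_poly x)`_j.-1 * (shift_poly x)`_j.+1 < 0.
Proof.
case: j => // j /= jn aj.
have [|aj1] := eqVneq (shift_poly x)`_j 0; [by left|right].
pose p := (shift_poly x)^`(j).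
have pE i : p`_i = (shift_poly x)`_(j + i) *+ (j + i) ^_ j by rewrite coef_derivn.
have sp : (1 < size p)%N.
  rewrite ltnNge; apply/negP => /leq_sizeP/(_ (n - j)%N); rewrite subn_gt0.
  move/(_ jn)/eqP; rewrite pE subnKC ?(ltnW jn) // coefn_shift_poly.
  by rewrite pnatr_eq0 gtn_eqF // ffact_gt0 ltnW.
have := laguerre (real_rooted_derivn j (real_rooted_shift_poly x)) sp (a := 0).
rewrite -/p !horner_coef0 !coef_deriv !pE addn0 addn1 aj !mul0rn expr0n /=.
rewrite addn2 mulrn_eq0 negb_or -lt0n ffact_gt0 leqnn aj1 => /(_ isT).
rewrite ffactnn -!mulrnA !mulrnAr !mulrnAl.
by rewrite !pmulrn_llt0 ?muln_gt0 ?ffact_gt0 ?fact_gt0 ?andbT //= -addn2 leq_addr.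
Qed.

(** If the coefficient of some degree j > k vanishes, so do all lower ones, by
    [shift_poly_newton].  The first step uses that coefficients of degree at
    least k cannot have opposite signs, the others that two consecutive
    coefficients are 0.  Then f_x has nonnegative coefficients only, hence no
    positive root, while each - x_i is a root. *)
Lemma relaxation_dichotomy k x : (k <= n)%N -> orthant_relaxation R n k x ->
  (forall i, 0 <= x i 0) \/ (forall j, (k < j <= n)%N -> 0 < (shift_poly x)`_j).
Proof.
move=> kn /(mem_relaxation_coef x kn) Kx.
have [pos|] := pselect (forall j, (k < j <= n)%N -> 0 < (shift_poly x)`_j); [by right|left].
have [j [/andP[kj jn] aj]] : exists j, (k < j <= n)%N /\ (shift_poly x)`_j = 0.
  apply: contrapT => nex; apply: b => j kjn; rewrite lt_def Kx; last by lia.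
  by rewrite andbT; apply/eqP => aj; apply: nex; exists j.
have low l : (l <= j)%N -> (shift_poly x)`_(j - l) = 0.
  elim/ltn_ind: l => -[|l] IH lj; first by rewrite subn0.
  have al : (shift_poly x)`_(j - l) = 0 by apply: IH; lia.
  have jl : (0 < j - l <= n)%N by lia.
  have := shift_poly_newton jl al; rewrite -subnS => -[//|].
  case: l IH lj {al jl} => [|l] IH lj.
    by rewrite subn0 ltNge mulr_ge0 // Kx //; lia.
  have -> : (j - l.+1).+1 = (j - l)%N by lia.
  by rewrite (IH l) ?mulr0 ?ltxx //; lia.
have pos i : 0 <= (shift_poly x)`_i.
  have [ij|ji] := leqP i j; first by rewrite -(subKn ij) low // leq_subr.
  by apply: Kx; lia.
move=> i; rewrite leNgt; apply/negP => xi0.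
have : 0 < (shift_poly x).[- x i 0].
  by apply: horner_gt0 => //; rewrite ?monic_neq0 ?monic_shift_poly // oppr_gt0.
by rewrite horner_prod (bigD1 i) //= !hornerE addNr mul0r ltxx.
Qed.
End ShiftPoly.

(** * Tangent half-spaces *)

Lemma deriv_prod_seq (S : comNzRingType) (I : eqType) (s : seq I) (F : I -> {poly S}) :
  uniq s -> (\prod_(i <- s) F i)^`() =
    \sum_(i <- s) (F i)^`() * \prod_(l <- s | l != i) F l.
Proof.
elim: s => [|m s IH] /=; first by rewrite !big_nil -polyC1 derivC.
case/andP=> ms us; rewrite !big_cons eqxx derivM IH //=.
congr (_ * _ + _).
  rewrite [LHS]big_seq [RHS]big_seq_cond; apply: eq_bigl => l.
  by case: eqP => [->|]; rewrite ?andbT // andbF (negPf ms).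
rewrite big_distrr /= [LHS]big_seq [RHS]big_seq; apply: eq_bigr => i is_.
rewrite big_cons; case: eqP is_ ms => [<- ->//|_ _ _].
by rewrite mulrCA.
Qed.

Lemma deriv_prod (S : comNzRingType) (I : finType) (F : I -> {poly S}) :
  (\prod_i F i)^`() = \sum_i (F i)^`() * \prod_(l | l != i) F l.
Proof. exact/deriv_prod_seq/index_enum_uniq. Qed.

Lemma horner_gt0_near0 (R : rcfType) (p : {poly R}) :
  0 < p`_0 \/ p`_0 = 0 /\ 0 < p`_1 ->
  exists2 d, 0 < d & forall t, 0 < t < d -> 0 < p.[t].
Proof.
have pos0 (q : {poly R}) : 0 < q`_0 -> exists2 d, 0 < d & forall t, 0 < t < d -> 0 < q.[t].
  rewrite -horner_coef0 => q0; have [d d0 qd] := poly_cont 0 q q0.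
  exists d => // t /andP[t0 td]; have := qd t.
  rewrite subr0 gtr0_norm // => /(_ td); rewrite ltr_norml => /andP[+ _].
  by rewrite ltrBrDr addNr.
case=> [/pos0//|[]]; elim/poly_ind: p => [|p c _]; first by rewrite !coef0 ltxx.
rewrite !coefD !coefMX !coefC /= add0r addr0 => -> /pos0[d d0 pd].
exists d => // t td; rewrite addr0 hornerMX mulr_gt0 ?pd //.
by case/andP: td.
Qed.

Lemma uniform_near0 (R : realFieldType) (N : nat) (P : nat -> R -> Prop) :
  (forall j, (j < N)%N -> exists2 d, 0 < d & forall t, 0 < t < d -> P j t) ->
  exists2 d, 0 < d & forall t, 0 < t < d -> forall j, (j < N)%N -> P j t.
Proof.
elim: N => [|N IH] PN; first by exists 1.
have [j jN|d d0 Pd] := IH; first by apply: PN; lia.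
have [d' d'0 Pd'] := PN N (ltnSn N).
exists (Num.min d d') => [|t]; first by rewrite lt_min d0.
rewrite lt_min => /and3P[t0 td td'] j; rewrite ltnS leq_eqVlt => /predU1P[->|jN].
  by apply: Pd'; rewrite t0.
by apply: Pd => //; rewrite t0.
Qed.

(** The form l need not support K: only the directions strictly on its positive
    side matter, which makes the notion usable without knowing that K is
    convex. *)
Definition tangent_halfspace (R : realType) (n : nat) (K : set 'cV[R]_n) (x : 'cV[R]_n) :=
  exists2 l : 'rV[R]_n, l != 0 & forall y, 0 < (l *m y) 0 0 ->
    exists2 d, 0 < d & forall t, 0 < t < d -> K (x + t *: y).

(** The linear form with values li, lp, lq on e_i, e_p, e_q is made positive on
    c e_i + a e_p - b e_q, while s_2 equals - a b < 0 on the last two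
    coordinates. *)
Lemma exists_same_sign_weights (R : realFieldType) (lp lq li : R) : lp != 0 \/ li != 0 ->
  exists a b c : R, 0 < a * b /\ 0 < a * lp - b * lq + c * li.
Proof.
(* With li = 0 the weights a and b have the sign of lp, and b is small enough
   compared with a for a lp to dominate b lq. *)
have [li0 [lp0|//]|li0 _] := eqVneq li 0; last first.
  by exists 1, 1, ((1 - lp + lq) / li); rewrite divfK // !mul1r; split; lra.
have q1 : 0 < 1 + `|lq| by rewrite ltr_pwDl.
exists (lp * (1 + `|lq|)), (lp * `|lp|), 0.
have lp2 : 0 < lp ^+ 2 by rewrite exprn_even_gt0.
have lpn : 0 < `|lp| by rewrite normr_gt0.
split.
  have := mulr_gt0 (mulr_gt0 lp2 lpn) q1; congr (0 < _); ring.
rewrite mul0r addr0.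
have : lp * lq <= `|lp| * `|lq| by rewrite -normrM ler_norm.
have : lp ^+ 2 = `|lp| ^+ 2 by rewrite real_normK // num_real.
nra.
Qed.

Section Tangent.
Variables (R : realType) (n : nat).
Implicit Types (x y : 'cV[R]_n) (k : nat).

(** First-order expansion of an elementary symmetric function along a line.
    The coefficients of p are read off a polynomial G in t with coefficients in
    {poly R} such that G(t) is f at x + t y. *)
Lemma shift_poly_line x y j : exists p : {poly R},
  [/\ forall t, (shift_poly (x + t *: y))`_j = p.[t],
      p`_0 = (shift_poly x)`_j
    & p`_1 = \sum_i (\prod_(l | l != i) ('X + (x l 0)%:P))`_j * y i 0].
Proof.
pose G : {poly {poly R}} := \prod_i (('X + (x i 0)%:P)%:P + ((y i 0)%:P)%:P * 'X).
exists (map_poly (coefp j) G); split=> [t||].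
- rewrite (horner_coef_wide _ (size_poly _ _)).
  have -> : shift_poly (x + t *: y) = G.[t%:P].
    rewrite /shift_poly horner_prod; apply: eq_bigr => i _.
    by rewrite !hornerE !mxE polyCD polyCM -addrA [t%:P * _]mulrC.
  rewrite horner_coef coef_sum; apply: eq_bigr => i _.
  by rewrite coef_map -polyC_exp coefMC.
- have <- : G.[0] = shift_poly x.
    rewrite /shift_poly horner_prod; apply: eq_bigr => i _.
    by rewrite !hornerE.
  by rewrite coef_map -horner_coef0.
- have G1 : G`_1 = \sum_i (y i 0)%:P * \prod_(l | l != i) ('X + (x l 0)%:P).
    have -> : G`_1 = G^`().[0] by rewrite horner_coef0 coef_deriv mulr1n.
    rewrite deriv_prod horner_sum; apply: eq_bigr => i _.
    rewrite derivD derivC add0r derivM derivC mul0r add0r derivX mulr1.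
    rewrite hornerM hornerC horner_prod; congr (_ * _).
    by apply: eq_bigr => l _; rewrite !hornerE.
  rewrite coef_map G1 /= coef_sum; apply: eq_bigr => i _.
  by rewrite coefCM mulrC.
Qed.

(** The form is the gradient of the coefficient of degree k.  It is nonzero
    because its value on (1, ..., 1) is the coefficient of degree k of the
    derivative of f_x. *)
Lemma tangent_halfspace_relaxation k x : (k < n)%N -> orthant_relaxation R n k x ->
  (forall j, (k < j <= n)%N -> 0 < (shift_poly x)`_j) ->
  tangent_halfspace (orthant_relaxation R n k) x.
Proof.
move=> kn /(mem_relaxation_coef x (ltnW kn)) Kx pos.
exists (\row_i (\prod_(l | l != i) ('X + (x l 0)%:P))`_k).
  have : 0 < (shift_poly x)^`()`_k.
    by rewrite coef_deriv pmulrn_lgt0 // pos // ltnSn.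
  apply: contraTneq => l0; rewrite deriv_prod coef_sum big1 ?ltxx // => i _.
  rewrite derivD derivX derivC addr0 mul1r.
  by move/rowP/(_ i): l0; rewrite !mxE.
move=> y ly.
have [|d d0 Pd] := @uniform_near0 R n.+1
    (fun j t => (k <= j)%N -> 0 <= (shift_poly (x + t *: y))`_j).
  move=> j jn; have [kj|jk] := leqP k j; last by exists 1 => // t _; lia.
  have [p [pE p0 p1]] := shift_poly_line x y j.
  have [|d d0 pd] := @horner_gt0_near0 R p.
    rewrite p0; have [aj|nz] := eqVneq (shift_poly x)`_j 0; last first.
      by left; rewrite lt_def Kx // nz.
    right; split=> //; have jk : j = k.
      apply/eqP; rewrite eqn_leq kj andbT leqNgt; apply/negP => jk.
      by have := pos j; rewrite aj ltxx jk => /(_ jn).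
    rewrite p1 jk; move: ly; rewrite mxE; congr (0 < _).
    by apply: eq_bigr => i _; rewrite mxE.
  by exists d => // t td _; rewrite pE ltW // pd.
exists d => // t td; apply/(mem_relaxation_coef _ (ltnW kn)) => j kj.
have [jn|nj] := ltnP j n.+1; first exact: Pd.
by rewrite nth_default // size_shift_poly.
Qed.

Lemma shift_poly_3 (i p q : 'I_n) (u v w : R) : i != p -> i != q -> p != q ->
  shift_poly (u *: delta_mx i 0 + v *: delta_mx p 0 + w *: delta_mx q 0) =
    ('X + u%:P) * ('X + v%:P) * ('X + w%:P) * 'X^(n - 3).
Proof.
move=> ip iq pq; rewrite /shift_poly (bigD1 i) // (bigD1 p) 1?eq_sym //=.
rewrite (bigD1 q) ?[q == _]eq_sym ?iq ?pq //= !mulrA; congr (_ * _).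
  rewrite !mxE !eqxx /= (negPf ip) (negPf iq) (negPf pq).
  rewrite [p == i]eq_sym [q == i]eq_sym [q == p]eq_sym (negPf ip) (negPf iq) (negPf pq).
  by rewrite /= !(mulr0, mulr1, addr0, add0r).
rewrite (eq_bigr (fun=> 'X)) => [|l /andP[/andP[li lp] lq]]; last first.
  by rewrite !mxE (negPf li) (negPf lp) (negPf lq) /= !mulr0 !addr0.
rewrite prodr_const; congr ('X^_).
have := cardsC (i |: [set p; q])%SET; rewrite card_ord cardsU1 cards2 !inE.
rewrite negb_or ip iq pq /= => nE.
have <- : (#|~: (i |: [set p; q])%SET| = n - 3)%N.
  by move: nE; set m := #|_|; lia.
by apply: eq_card => l; rewrite !inE !negb_or andbA.
Qed.

Lemma delta_in_relaxation k (i : 'I_n) : (k <= n)%N ->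
  orthant_relaxation R n k (delta_mx i 0).
Proof.
move=> kn; apply/(mem_relaxation_coef _ kn) => j _; apply: coef_ge0_prod => l _ m.
by rewrite coefD coefX coefC mxE; case: ifP => _; rewrite ?addr0 ?addr_ge0 ?ler0n.
Qed.

(** Three nonzero coordinates suffice.  For y = c e_i + a e_p - b e_q with
    a b > 0, the value s_3(e_i + t y) is the single product
    - (1 + t c) t^2 a b, negative for small t > 0; and such a y exists on the
    positive side of any nonzero linear form. *)
Lemma no_tangent_halfspace_delta k (i : 'I_n) : (4 <= n)%N -> (k <= n - 3)%N ->
  ~ tangent_halfspace (orthant_relaxation R n k) (delta_mx i 0).
Proof.
move=> n4 kn [l l0 tan].
have [p ip lp] : exists2 p, i != p & l 0 p != 0 \/ l 0 i != 0.
  have [li0|li0] := eqVneq (l 0 i) 0; last first.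
    have : (0 < #|~: [set i]%SET|)%N by have := cardsC [set i]%SET; rewrite cards1 card_ord; lia.
    by case/card_gt0P => p; rewrite !inE eq_sym => ip; exists p; rewrite ?li0; auto.
  have [p lp] : exists p, l 0 p != 0.
    apply/existsP; apply: contraNT l0; rewrite negb_exists => /forallP l0.
    by apply/eqP/rowP => p; rewrite mxE; apply/eqP; have := l0 p; rewrite negbK.
  by exists p; [apply: contraNneq lp => <-; rewrite li0|left].
have [q /andP[iq pq]] : exists q, (i != q) && (p != q).
  have : (0 < #|~: [set i; p]%SET|)%N.
    by have := cardsC [set i; p]%SET; rewrite cards2 card_ord; lia.
  by case/card_gt0P => q; rewrite !inE negb_or ![q == _]eq_sym; exists q.
have [a [b [c [ab ly]]]] := exists_same_sign_weights (l 0 q) lp.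
have kn' : (k <= n)%N by lia.
have [|d d0 Kd] := tan (c *: delta_mx i 0 + a *: delta_mx p 0 + (- b) *: delta_mx q 0).
  rewrite !mulmxDr -!scalemxAr -!colE !mxE mulNr.
  by move: ly; congr (0 < _); ring.
(* t < d uses the assumed tangent half-space, t < 1 / (1 + |c|) makes
   1 + t c positive. *)
pose t := Num.min d (1 + `|c|)^-1 / 2.
have c1 : 0 < 1 + `|c| by rewrite ltr_pwDl.
have m0 : 0 < Num.min d (1 + `|c|)^-1 by rewrite lt_min d0 invr_gt0.
have t0 : 0 < t by rewrite divr_gt0.
have tm : t < Num.min d (1 + `|c|)^-1 by rewrite ltr_pdivrMr //; lra.
move: t t0 tm => t t0; rewrite lt_min => /andP[td tc].
have := Kd t; rewrite t0 td => /(_ isT) /(mem_relaxation_coef _ kn')/(_ (n - 3)%N kn).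
rewrite !scalerDr !scalerA !addrA -[X in X + _ + _ + _]scale1r -scalerDl.
rewrite shift_poly_3 // coefMXn ltnn subnn -horner_coef0 !hornerE /=.
have tc1 : 0 < 1 + t * c.
  have : t * (1 + `|c|) < 1 by rewrite -ltr_pdivlMr // div1r.
  have : - `|c| <= c by rewrite lerNl -normrN ler_norm.
  by nra.
have := mulr_gt0 tc1 (mulr_gt0 (mulr_gt0 t0 t0) ab).
rewrite leNgt => pos /negP; apply; rewrite -oppr_gt0.
by move: pos; congr (0 < _); ring.
Qed.
End Tangent.

(** * Automorphisms *)

(** The off-diagonal entries of A B and B A are sums of nonnegative terms, so
    every term vanishes.  Two nonzero entries of A in the same column j would then
    annihilate row j of B, and two in the same row i, in columns j and j', would
    contradict the vanishing of B j i * A i j'. *)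
Lemma nonneg_inverse_monomial (R : realFieldType) (n : nat) (A B : 'M[R]_n) :
  A *m B = 1%:M -> B *m A = 1%:M ->
  (forall i j, 0 <= A i j) -> (forall i j, 0 <= B i j) ->
  exists s : 'S_n, (forall j, 0 < A (s j) j) /\ (forall i j, i != s j -> A i j = 0).
Proof.
move=> AB BA A0 B0.
have zero (C D : 'M[R]_n) : (forall i j, 0 <= C i j) -> (forall i j, 0 <= D i j) ->
    C *m D = 1%:M -> forall i j l, i != l -> C i j * D j l = 0.
  move=> C0 D0 CD i j l il; have := congr1 (fun M : 'M[R]_n => M i l) CD.
  rewrite !mxE (negPf il) => S0; apply: (psumr_eq0P _ S0) => // m _.
  exact: mulr_ge0.
have one j : exists2 i, B j i != 0 & 0 < A i j.
  have := congr1 (fun M : 'M[R]_n => M j j) BA; rewrite !mxE eqxx mulr1n => S1.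
  have [i _ nz] : exists2 i, true & B j i * A i j != 0.
    apply: contrapT => nex; have := @oner_neq0 R; rewrite -S1 big1 ?eqxx // => i _.
    by apply/eqP; rewrite -[_ == _]negbK; apply/negP => nz; apply: nex; exists i.
  move: nz; rewrite mulf_eq0 negb_or => /andP[Bn An].
  by exists i => //; rewrite lt_def An A0.
have Bzero i j l : A i j != 0 -> i != l -> B j l = 0.
  by move=> Aij il; have /eqP := zero _ _ A0 B0 AB i j l il; rewrite mulf_eq0 (negPf Aij) => /eqP.
have col i i' j : A i j != 0 -> A i' j != 0 -> i = i'.
  move=> Ai Ai'; apply/eqP; apply: contraT => ii'; have [l Bl _] := one j.
  have [il|il] := eqVneq i l; last by rewrite (Bzero _ _ _ Ai il) eqxx in Bl.
  by rewrite (Bzero _ _ l Ai') ?eqxx // -il eq_sym in Bl.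
have row i j j' : A i j != 0 -> A i j' != 0 -> j = j'.
  move=> Aj Aj'; apply/eqP; apply: contraT => jj'; have [l Bl Al] := one j.
  have il : i = l by apply: (col _ _ j) => //; rewrite gt_eqF.
  have /eqP := zero _ _ B0 A0 BA j l j' jj'.
  by rewrite mulf_eq0 (negPf Bl) -il (negPf Aj').
have /fin_all_exists[f fA] j : exists i, 0 < A i j by have [i _ Ai] := one j; exists i.
have finj : injective f.
  by move=> j j' fj; apply: (row (f j)); rewrite gt_eqF // fj.
exists (perm finj); split=> [j|i j]; rewrite permE // => ifj.
apply/eqP; apply: contraT => Aij; rewrite (col _ _ _ Aij (_ : A (f j) j != 0)) ?eqxx // in ifj.
by rewrite gt_eqF.
Qed.

Section ConeAut.
Variables (R : realType) (n : nat) (K : set 'cV[R]_n).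
Implicit Types (A : 'M[R]_n) (x : 'cV[R]_n).

Lemma cone_autP A : A \in unitmx -> (forall x, K (A *m x) <-> K x) -> cone_aut K A.
Proof.
move=> uA AK; split=> //; apply/seteqP; split=> [_ [x Kx <-]|y Ky]; first exact/AK.
by exists (invmx A *m y); [apply/AK|]; rewrite mulKVmx.
Qed.

Lemma cone_aut_mem A x : cone_aut K A -> K (A *m x) <-> K x.
Proof.
move=> [uA AK]; split=> [|Kx]; last by rewrite -AK; exists x.
by rewrite -[X in X (A *m x)]AK => -[y Ky /(can_inj (mulKmx uA)) <-].
Qed.

Lemma cone_aut_inv A : cone_aut K A -> cone_aut K (invmx A).
Proof.
move=> aA; have uA := aA.1; apply: cone_autP => [|x]; first by rewrite unitmx_inv.
by rewrite -(cone_aut_mem _ aA) mulKVmx.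
Qed.

Lemma tangent_halfspace_aut A x : cone_aut K A ->
  tangent_halfspace K (A *m x) -> tangent_halfspace K x.
Proof.
move=> aA [l l0 tan]; exists (l *m A).
  by apply: contraNneq l0 => lA; rewrite -(mulmxK aA.1 l) lA mul0mx.
move=> y; rewrite -mulmxA => /tan [d d0 Kd]; exists d => // t /Kd.
by rewrite scalemxAr -mulmxDr (cone_aut_mem _ aA).
Qed.
End ConeAut.

(** * Automorphisms of the relaxed orthant *)

Lemma coef_X1n (R : comNzRingType) (N m : nat) :
  (('X + 1%:P : {poly R}) ^+ N)`_m = 'C(N, m)%:R.
Proof.
rewrite polyC1 exprD1n coef_sum.
rewrite (eq_bigr (fun i : 'I_N.+1 => if m == i then 'C(N, m)%:R else 0)); last first.
  by move=> i _; rewrite coefMn coefXn; case: eqP => [->|]; rewrite ?mul0rn.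
have [mN|Nm] := ltnP m N.+1.
  by rewrite -big_mkcond (big_pred1 (Ordinal mN)).
by rewrite big1 ?bin_small // => i _; case: eqP => // mi; have := ltn_ord i; lia.
Qed.

Lemma bin_le_mul (N m : nat) : ('C(N, m.+1) <= N * 'C(N, m))%N.
Proof.
have := mul_bin_left N m; have : ('C(N, m.+1) <= m.+1 * 'C(N, m.+1))%N by rewrite leq_pmull.
move=> h1 h2; rewrite (leq_trans h1) // h2 leq_mul2r leq_subr orbT //.
Qed.

Lemma coef_quadratic_mul (R : comNzRingType) (P : {poly R}) (u v : R) (e r : nat) :
  (P * (('X + u%:P) * ('X + v%:P)) * 'X^e)`_(e + r.+1) =
  (if r is r'.+1 then P`_r' else 0) + (u + v) * P`_r + u * v * P`_r.+1.
Proof.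
rewrite coefMXn ltnNge leq_addr addKn /=.
have -> : ('X + u%:P) * ('X + v%:P) = 'X * 'X + (u + v) *: 'X + (u * v)%:P :> {poly R}.
  by rewrite -mul_polyC polyCD polyCM; ring.
rewrite !mulrDr mulrA -scalerAr !coefD coefZ coefMC !coefMX /= [P`_r.+1 * _]mulrC.
by case: r.
Qed.

Section RelaxationAut.
Variables (R : realType) (n k : nat).
Hypotheses (hn : (4 <= n)%N) (hk : (1 <= k <= n - 3)%N).
Local Notation K := (orthant_relaxation R n k).

(** Column j of A is the image of e_j, where K has no tangent half-space. *)
Lemma relaxation_aut_ge0 (A : 'M[R]_n) : cone_aut K A -> forall i j, 0 <= A i j.
Proof.
move=> aA i j; have kn : (k < n)%N by lia.
have KA : K (A *m delta_mx j 0).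
  by apply/cone_aut_mem => //; apply: delta_in_relaxation; exact: ltnW.
have [pos|pos] := relaxation_dichotomy (ltnW kn) KA.
  by have := pos i; rewrite -colE mxE.
have /(tangent_halfspace_aut aA) tan := tangent_halfspace_relaxation kn KA pos.
by case: (no_tangent_halfspace_delta hn _ tan); lia.
Qed.

Lemma shift_poly_monomial (A : 'M[R]_n) (s : 'S_n) (x : 'cV[R]_n) :
  (forall i j, i != s j -> A i j = 0) ->
  shift_poly (A *m x) = \prod_j ('X + (A (s j) j * x j 0)%:P).
Proof.
move=> A0; rewrite /shift_poly (reindex_inj (@perm_inj _ s)); apply: eq_bigr => j _.
rewrite mxE (bigD1 j) //= big1 ?addr0 // => l lj.
by rewrite A0 ?mul0r // (inj_eq perm_inj) eq_sym.
Qed.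

(** A perturbation of the 0/1 vector of T in the directions i and j. *)
Definition test_vector (T : {set 'I_n}) (i j : 'I_n) (u v : R) : 'cV[R]_n :=
  \col_l (if l \in T then 1 else if l == i then u else if l == j then v else 0).

Lemma prod_test_vector (T : {set 'I_n}) (i j : 'I_n) (u v : R) (d : 'I_n -> R) :
  i != j -> i \notin T -> j \notin T ->
  \prod_l ('X + (d l * test_vector T i j u v l 0)%:P) =
  (\prod_(l in T) ('X + (d l)%:P)) * (('X + (d i * u)%:P) * ('X + (d j * v)%:P))
    * 'X^(n - #|T| - 2).
Proof.
move=> ij iT jT; rewrite (bigID (mem T)) /= -mulrA; congr (_ * _).
  by apply: eq_bigr => l lT; rewrite mxE lT mulr1.
rewrite (bigD1 i) // (bigD1 j) 1?eq_sym ?jT //= mulrA; congr (_ * _).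
  by rewrite !mxE (negPf iT) (negPf jT) eqxx [j == i]eq_sym (negPf ij) eqxx.
rewrite (eq_bigr (fun=> 'X)) => [|l /andP[/andP[lT li] lj]]; last first.
  by rewrite mxE (negPf lT) (negPf li) (negPf lj) mulr0 addr0.
rewrite prodr_const; congr ('X^_).
have := cardsC (i |: (j |: T))%SET; rewrite card_ord !cardsU1 !inE negb_or ij iT jT /= => nE.
have <- : (#|~: (i |: (j |: T))%SET| = n - #|T| - 2)%N.
  by move: nE; set m := #|~: _|; set r := #|T|; lia.
apply: eq_card => l; rewrite [LHS]unfold_in !inE !negb_or.
by case: (l \in T); case: (l == i); case: (l == j).
Qed.

(** With N = #|T| = n - k - 1, the product is
    (X + 1)^N (X^2 + t (1 - c) X - c t^2) X^(k-1), whose only negative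
    contributions come from - c t^2.  They are absorbed since consecutive binomial
    coefficients satisfy C(N, r + 1) <= N C(N, r). *)
Lemma test_vector_in_relaxation (T : {set 'I_n}) (i j : 'I_n) (t c : R) :
  i != j -> i \notin T -> j \notin T -> #|T| = (n - k - 1)%N ->
  0 < t -> 0 < c < 1 -> t * n%:R <= 1 - c -> K (test_vector T i j t (- (c * t))).
Proof.
move=> ij iT jT cT t0 /andP[c0 c1] tc.
apply/mem_relaxation_coef => [|m km]; first by lia.
have := prod_test_vector t (- (c * t)) (fun=> 1) ij iT jT.
rewrite (eq_bigr (fun l => 'X + (test_vector T i j t (- (c * t)) l 0)%:P)); last first.
  by move=> l _; rewrite mul1r.
rewrite -/(shift_poly _) => ->; rewrite prodr_const cT.
have [r ->] : exists r, (m = n - (n - k - 1) - 2 + r.+1)%N by exists (m - k)%N; lia.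
rewrite coef_quadratic_mul !mul1r; set N := (n - k - 1)%N; rewrite !coef_X1n.
have N1 : ('C(N, r.+1))%:R <= n%:R * ('C(N, r))%:R :> R.
  by rewrite -natrM ler_nat (leq_trans (bin_le_mul _ _)) // leq_mul2r; lia.
have b0 : 0 <= ('C(N, r))%:R :> R by [].
rewrite -addrA addr_ge0 //; first by case: r {N1 b0} => [|r]; rewrite ?coef_X1n.
move: 'C(N, r)%:R 'C(N, r.+1)%:R n%:R tc N1 b0 => b b' m' tc N1 b0.
have h1 : b' * t <= (1 - c) * b.
  by apply: le_trans (ler_wpM2r (ltW t0) N1) _; rewrite mulrAC ler_wpM2r // mulrC.
have h2 : 0 <= (1 - c) * b by rewrite mulr_ge0 // subr_ge0 ltW.
have h3 := ler_wpM2l (ltW t0) h1.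
have h4 := mulr_ge0 (ltW t0) h2.
have h5 := ler_wpM2l (ltW c0) h3.
have h6 := ler_wpM2r h4 (ltW c1).
by move: h5 h6; lra.
Qed.

(** If d_i < d_j, some c < 1 has d_i < c d_j.  The vector with entries 1 on T,
    t at i and - c t at j lies in K for small t > 0.  In the polynomial of its
    image, the factor coming from i and j is
    X^2 + t (d_i - c d_j) X - c t^2 d_i d_j with two negative coefficients, so
    the coefficient of degree k is negative. *)
Lemma monomial_aut_constant (A : 'M[R]_n) (s : 'S_n) (i j : 'I_n) :
  cone_aut K A -> (forall j, 0 < A (s j) j) -> (forall i j, i != s j -> A i j = 0) ->
  A (s j) j <= A (s i) i.
Proof.
move=> aA Apos A0; have [->//|ij] := eqVneq i j.
have kn : (k <= n)%N by lia.
have kE : (k = n - (n - k - 1) - 2 + 1)%N by lia.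
have n0 : 0 < n%:R :> R by rewrite ltr0n; lia.
rewrite leNgt; apply/negP; pose d (l : 'I_n) : R := A (s l) l.
rewrite -/(d i) -/(d j) => dij; have di : 0 < d i := Apos i; have dj : 0 < d j := Apos j.
have [T [iT jT cT]] : exists T : {set 'I_n}, [/\ i \notin T, j \notin T & #|T| = (n - k - 1)%N].
  have : (n - k - 1 <= #|~: [set i; j]%SET|)%N.
    by have := cardsC [set i; j]%SET; rewrite cards2 ij card_ord; lia.
  case/card_geqP => e [ue se eT]; exists [set x in e]%SET; split.
  - by rewrite inE; apply/negP => /eT; rewrite !inE eqxx.
  - by rewrite inE; apply/negP => /eT; rewrite !inE eqxx orbT.
  - by rewrite cardsE (card_uniqP ue).
have [c [c0 c1 cd]] : exists c, [/\ 0 < c, c < 1 & d i < c * d j].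
  have q0 : 0 < d i / d j by rewrite divr_gt0.
  have q1 : d i / d j < 1 by rewrite ltr_pdivrMr // mul1r.
  exists ((d i / d j + 1) / 2); split; [lra|lra|].
  by rewrite -ltr_pdivrMr //; lra.
have [t t0 tn] : exists2 t, 0 < t & t * n%:R <= 1 - c.
  by exists ((1 - c) / n%:R); rewrite ?divr_gt0 ?subr_gt0 // divfK // gt_eqF.
have c01 : 0 < c < 1 by rewrite c0.
have Kz := test_vector_in_relaxation ij iT jT cT t0 c01 tn.
have /(mem_relaxation_coef _ kn)/(_ k (leqnn k)) := (cone_aut_mem _ aA).2 Kz.
rewrite (shift_poly_monomial _ A0) (prod_test_vector _ _ d ij iT jT) cT.
set P := \prod_(l in T) _.
rewrite [X in _`_X]kE coef_quadratic_mul add0r.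
have P0 : 0 < P`_0.
  rewrite -horner_coef0 horner_prod prodr_gt0 // => l _.
  by rewrite !hornerE Apos.
have P1 : 0 <= P`_1.
  apply: coef_ge0_prod => l _ m; rewrite coefD coefX coefC.
  by case: ifP => _; rewrite ?addr0 ?ler0n // addr_ge0 ?ler0n // ltW // Apos.
have h1 := mulr_gt0 (mulr_gt0 t0 (_ : 0 < c * d j - d i)) P0.
have h2 := mulr_ge0 (ltW (mulr_gt0 (mulr_gt0 di t0) (mulr_gt0 dj (mulr_gt0 c0 t0)))) P1.
move: h1 (h2); rewrite subr_gt0 => /(_ cd); clear -h2.
move: (P`_0) (P`_1) (d i) (d j) => p0 p1 di dj; lra.
Qed.

(** Homogeneity in degree n - j; the powers of a are distributed so that no
    inverse or subtraction appears. *)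
Lemma coef_shift_poly_scaled_perm (a : R) (s : 'S_n) (x : 'cV[R]_n) (j : nat) :
  (shift_poly ((a *: perm_mx s) *m x))`_j * a ^+ j = a ^+ n * (shift_poly x)`_j.
Proof.
have -> : shift_poly ((a *: perm_mx s) *m x) = \prod_(i < n) ('X + (a * x i 0)%:P).
  rewrite [RHS](reindex_inj (@perm_inj _ s)); apply: eq_bigr => i _.
  by rewrite -scalemxAl -row_permE !mxE.
have an : a ^+ n = \prod_(i < n) a by rewrite prodr_const card_ord.
rewrite an /shift_poly; elim/big_rec3: _ j => [|i p b q _ IH] j.
  by rewrite mul1r coef1; case: j => [|j]; rewrite ?mulr1 ?mul0r.
rewrite !mulrDl !coefD !coefXM !coefCM !mulrDl mulrDr; congr (_ + _).
  case: j => [|j]; first by rewrite mul0r mulr0.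
  by rewrite exprSr mulrA IH /=; ring.
by rewrite -[LHS]mulrA IH; ring.
Qed.

Lemma scaled_perm_aut (a : R) (s : 'S_n) : 0 < a -> cone_aut K (a *: perm_mx s).
Proof.
move=> a0; have kn : (k <= n)%N by lia.
apply: cone_autP => [|x].
  by rewrite unitmxZ ?unitmx_perm // unitfE gt_eqF.
have sgn j : (0 <= (shift_poly ((a *: perm_mx s) *m x))`_j) = (0 <= (shift_poly x)`_j).
  rewrite -(pmulr_lge0 _ (exprn_gt0 j a0)) coef_shift_poly_scaled_perm.
  by rewrite pmulr_rge0 // exprn_gt0.
by split=> /(mem_relaxation_coef _ kn) Kx; apply/(mem_relaxation_coef _ kn) => j kj;
  [rewrite -sgn|rewrite sgn]; apply: Kx.
Qed.

Lemma relaxation_aut_scaled_perm (A : 'M[R]_n) : cone_aut K A ->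
  exists (a : R) (s : 'S_n), 0 < a /\ A = a *: perm_mx s.
Proof.
move=> aA; have [s [Apos A0]] := nonneg_inverse_monomial (mulmxV aA.1) (mulVmx aA.1)
  (relaxation_aut_ge0 aA) (relaxation_aut_ge0 (cone_aut_inv aA)).
have i0 : 'I_n by exists 0%N; lia.
exists (A (s i0) i0), (s^-1)%g; split=> //; apply/matrixP => i j.
rewrite !mxE; have [->|isj] := eqVneq i (s j).
  rewrite permK eqxx mulr1.
  by apply/le_anti; rewrite !(monomial_aut_constant _ _ aA Apos A0).
rewrite A0 //; case: eqP => [sij|_]; last by rewrite mulr0.
by rewrite -sij permKV eqxx in isj.
Qed.
End RelaxationAut.

Unset Implicit Arguments.

Theorem theorem4p1 (R : realType) (n k : nat) (hn : (4 <= n)%N)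
    (hk : (1 <= k <= n - 3)%N) :
  cone_aut (orthant_relaxation R n k) =
  [set A : 'M[R]_n | exists (alpha : R) (P : 'M[R]_n),
      [/\ 0 < alpha, is_perm_mx P & A = alpha *: P]].
Proof.
apply/seteqP; split=> [A /(relaxation_aut_scaled_perm hn hk) [a [s [a0 ->]]]|A].
  by exists a, (perm_mx s); rewrite perm_mx_is_perm.
by move=> [a [_ [a0 /is_perm_mxP[s ->] ->]]]; apply: scaled_perm_aut.
Qed.
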